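(* $\Sigma$ is closed under the smash product $\#$.
   Context: Let $\mathcal{S}=\bigoplus_{n\ge0}\Bbbk S_n$ over a field of characteristic $0$, with each $\sigma\in S_n$ viewed as the endomorphism $v_1\cdots v_n\mapsto v_{\sigma(1)}\cdots v_{\sigma(n)}$ of $V^{\otimes n}$ in the tensor Hopf algebra $T(V)$ ($\dim V=\infty$, $v\mapsto 1\otimes v+v\otimes 1$). The smash product $\#$ on $\mathcal{S}$ is the restriction of the smash product of endomorphisms $f\# g=m\circ(1\otimes g)\circ(1\otimes m)\circ\mathrm{cyclic}\circ(\Delta\otimes1)\circ(f\otimes1)\circ\Delta$ of $T(V)$ (with $\mathrm{cyclic}(x\otimes y\otimes z)=y\otimes z\otimes x$), under which $\mathcal{S}$ is closed. For $\sigma\in S_n$ let $\operatorname{Des}(\sigma)=\{i\in[n-1]:\sigma(i)>\sigma(i+1)\}$, and for $J\subseteq[n-1]$ let $X_J=\sum_{\sigma\in S_n,\ \operatorname{Des}(\sigma)\subseteq J}\sigma$; index these by compositions via $(a_1,\ldots,a_r)\leftrightarrow\{a_1,a_1+a_2,\ldots,a_1+\cdots+a_{r-1}\}$. Let $\Sigma_n\subseteq\Bbbk S_n$ be the span of the $X_\alpha$, $\alpha$ a composition of $n$, and $\Sigma=\bigoplus_{n\ge0}\Sigma_n$. *)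

(* Defs.v *)
From HB Require Import structures.
From mathcomp Require Import all_boot all_order all_fingroup all_algebra.
From mathcomp Require Import finmap.
From mathcomp.multinomials Require Import xfinmap monalg.

Set Implicit Arguments.
Unset Strict Implicit.
Unset Printing Implicit Defensive.

Import GRing.Theory BigEnoughFSet.
Local Open Scope ring_scope.

(* Linear extension of a map defined on the basis [K] of [{malg k[K]}]. *)
Section LinearExtension.
Context (k : fieldType) (K : choiceType) (M : lmodType k) (phi : K -> M).

Definition lin_ext (a : {malg k[K]}) : M := \sum_(x <- msupp a) a@_x *: phi x.

Lemma lin_extEw (d : {fset K}) (a : {malg k[K]}) :
  (msupp a `<=` d)%fset -> lin_ext a = \sum_(x <- d) a@_x *: phi x.
Proof.
move=> le; rewrite [LHS](big_fset_incl _ le) => //= x _ /mcoeff_outdom ->.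
by rewrite scale0r.
Qed.

Lemma lin_ext_is_linear : linear lin_ext.
Proof.
move=> c a b; pose_big_fset K E; rewrite 3?(lin_extEw (d := E)) //.
  rewrite scaler_sumr -big_split; apply/eq_bigr=> x _ /=.
  by rewrite mcoeffD mcoeffZ scalerDl scalerA.
by close.
Qed.

HB.instance Definition _ :=
  GRing.isLinear.Build k {malg k[K]} M *:%R lin_ext lin_ext_is_linear.

Lemma lin_extU (x : K) : lin_ext << x >> = phi x.
Proof. by rewrite (lin_extEw msuppU_le) big_seq_fset1 mcoeffUU scale1r. Qed.
End LinearExtension.

Lemma malgUE (k : fieldType) (K : choiceType) (c : k) (x : K) :
  << c *g x >> = c *: << x >> :> {malg k[K]}.
Proof.
by apply/malgP => y; rewrite mcoeffZ !mcoeffU; case: eqP; rewrite ?mulr1 ?mulr0.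
Qed.

Lemma malg_scalerAr (k : fieldType) (K : monomType) (c : k)
    (x y : {malg k[K]}) : c *: (x * y) = x * (c *: y).
Proof.
rewrite [x * y]malgME (malgMEw (fsubset_refl _) (msuppZ_le c y)) scaler_sumr.
apply: eq_bigr => u _; rewrite scaler_sumr; apply: eq_bigr => v _.
by rewrite malgUE [RHS]malgUE mcoeffZ mulrCA scalerA.
Qed.

Lemma malg_linear_ext (k : fieldType) (K : choiceType) (M : lmodType k)
    (f g : {linear {malg k[K]} -> M}) :
  (forall x, f << x >> = g << x >>) -> f =1 g.
Proof.
move=> fg a; rewrite (monalgE a) !linear_sum; apply: eq_bigr => x _ /=.
by rewrite malgUE !linearZ /= fg.
Qed.

(* The tensor product of the spaces with bases [K] and [L] is the space with  *)
(* basis [K * L]; for monoids [K] and [L], the product monoid makes           *)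
(* [{malg k[K * L]}] the tensor product algebra.                              *)
Section Tensor.
Context (k : fieldType).

Definition tens (K L : choiceType) (a : {malg k[K]}) (b : {malg k[L]}) :
    {malg k[(K * L)%type]} :=
  lin_ext (fun x => lin_ext (fun y => << (x, y) >>) b) a.

Definition tens_map (K L K' L' : choiceType)
    (f : {linear {malg k[K]} -> {malg k[K']}})
    (g : {linear {malg k[L]} -> {malg k[L']}}) :
    {malg k[(K * L)%type]} -> {malg k[(K' * L')%type]} :=
  lin_ext (fun p => tens (f << p.1 >>) (g << p.2 >>)).

HB.instance Definition _ (K L K' L' : choiceType)
    (f : {linear {malg k[K]} -> {malg k[K']}})
    (g : {linear {malg k[L]} -> {malg k[L']}}) :=
  GRing.Linear.copy (tens_map f g)
    (lin_ext (fun p => tens (f << p.1 >>) (g << p.2 >>))).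

Definition cyclic (K L N : choiceType) :
    {malg k[(K * L * N)%type]} -> {malg k[(L * (N * K))%type]} :=
  lin_ext (fun p => << (p.1.2, (p.2, p.1.1)) >>).

HB.instance Definition _ (K L N : choiceType) :=
  GRing.Linear.copy (@cyclic K L N)
    (lin_ext (fun p => << (p.1.2, (p.2, p.1.1)) >>)).
End Tensor.

Section ProductMonoid.
Context (M N : monomType).
Implicit Types p q r : (M * N)%type.

Let pone : (M * N)%type := (mone, mone).
Let pmul p q : (M * N)%type := (mmul p.1 q.1, mmul p.2 q.2).

Fact pmulA : associative pmul.
Proof. by move=> p q r; rewrite /pmul /= !mulmA. Qed.
Fact pmul1m : left_id pone pmul.
Proof. by case=> x y; rewrite /pmul /= !mul1m. Qed.
Fact pmulm1 : right_id pone pmul.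
Proof. by case=> x y; rewrite /pmul /= !mulm1. Qed.
Fact punitm p q : pmul p q = pone -> p = pone /\ q = pone.
Proof.
by case: p q => [x y] [x' y'] [/unitm [-> ->] /unitm [-> ->]].
Qed.

HB.instance Definition _ :=
  Choice_isMonomialDef.Build (M * N)%type pmulA pmul1m pmulm1 punitm.
End ProductMonoid.

(* If [V] is the vector space with basis [I], then [T(V)] is the free         *)
(* algebra on [I], with basis the words on [I].                               *)
Section TensorHopfAlgebra.
Context (k : fieldType) (I : choiceType).

Local Notation T := {malg k[{fmonom I}]}.
Local Notation T2 := {malg k[({fmonom I} * {fmonom I})%type]}.

Definition mult : T2 -> T := lin_ext (fun p => << mmul p.1 p.2 >>).
HB.instance Definition _ :=
  GRing.Linear.copy mult (lin_ext (fun p => << mmul p.1 p.2 >>)).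

(* The algebra morphism with [comult v = 1 (x) v + v (x) 1] for [v] in [V].   *)
Definition comult_word (w : {fmonom I}) : T2 :=
  \prod_(i <- w) (<< (mone, fmu i) >> + << (fmu i, mone) >>).
Definition comult : T -> T2 := lin_ext comult_word.
HB.instance Definition _ := GRing.Linear.copy comult (lin_ext comult_word).

Definition smash (f g : {linear T -> T}) : T -> T :=
  mult \o tens_map idfun g \o tens_map idfun mult \o
  @cyclic k {fmonom I} {fmonom I} {fmonom I} \o
  tens_map comult idfun \o tens_map f idfun \o comult.
HB.instance Definition _ (f g : {linear T -> T}) :=
  GRing.Linear.copy (smash f g)
    (mult \o tens_map idfun g \o tens_map idfun mult \o
     @cyclic k {fmonom I} {fmonom I} {fmonom I} \o
     tens_map comult idfun \o tens_map f idfun \o comult).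
End TensorHopfAlgebra.

(* The inclusion of [V] in [T(V)]. *)
Definition gen (k : fieldType) (I : choiceType) (v : {malg k[I]}) :
    {malg k[{fmonom I}]} :=
  lin_ext (fun i => << fmu i >>) v.

(* [(+)_n k S_n]: finitely supported functions on the disjoint union of the   *)
(* symmetric groups.                                                          *)
Definition sym_sum (k : fieldType) := {malg k[{n : nat & 'S_n}]}.
HB.instance Definition _ (k : fieldType) := GRing.Lmodule.on (sym_sum k).

Definition perm_elt (k : fieldType) (n : nat) (s : 'S_n) : sym_sum k :=
  << Tagged (fun n => 'S_n) s >>.

Section Action.
Context (k : fieldType) (I : choiceType).
Local Notation T := {malg k[{fmonom I}]}.

Definition perm_word (n : nat) (s : 'S_n) (w : {fmonom I}) : T :=
  if insub (w : seq I) is Some t then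
    << FMonom [seq tnth (t : n.-tuple I) (s i) | i <- enum 'I_n] >>
  else 0.

Definition sym_end (a : sym_sum k) : T -> T :=
  lin_ext (fun w => \sum_(s <- msupp a) a@_s *: perm_word (tagged s) w).
HB.instance Definition _ (a : sym_sum k) :=
  GRing.Linear.copy (sym_end a)
    (lin_ext (fun w => \sum_(s <- msupp a) a@_s *: perm_word (tagged s) w)).
End Action.
Arguments sym_end {k} I a _.

(* [comult] is the algebra morphism with [v |-> 1 (x) v + v (x) 1];           *)
(* [sym_end] extends the action on words to all products of vectors           *)
(* multilinearly and embeds [sym_sum k] in the endomorphisms of [T(V)] when   *)
(* [V] is infinite-dimensional.                                               *)
Section Checks.
Context (k : fieldType) (I : choiceType).
Local Notation T := {malg k[{fmonom I}]}.

Lemma genE (v : {malg k[I]}) (d : {fset I}) :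
  (msupp v `<=` d)%fset ->
  gen v = \sum_(x : d) << v@_(fsval x) *g fmu (fsval x) >>.
Proof.
move=> le; rewrite /gen (lin_extEw _ le) big_seq_fsetE /=.
by apply: eq_bigr => x _; rewrite -malgUE.
Qed.

Lemma prod_letters (J : Type) (r : seq J) (c : J -> k) (x : J -> I) :
  \prod_(j <- r) << c j *g fmu (x j) >>
    = << \prod_(j <- r) c j *g FMonom [seq x j | j <- r] >> :> T.
Proof.
elim: r => [|j r IH]; first by rewrite !big_nil /= -fmoneE.
rewrite !big_cons IH malgM_def fgmulUU; congr << _ *g _ >>.
by apply: val_inj; rewrite /= fmM fmU.
Qed.

Lemma prod_genE (n : nat) (v : 'I_n -> {malg k[I]}) (d : {fset I}) :
  (forall i, msupp (v i) `<=` d)%fset ->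
  \prod_(i < n) gen (v i) = \sum_(f : {ffun 'I_n -> d})
    << \prod_(i < n) (v i)@_(fsval (f i)) *g
       FMonom [seq fsval (f i) | i <- enum 'I_n] >>.
Proof.
move=> le; under eq_bigr => i _ do rewrite (genE (le i)).
rewrite bigA_distr_bigA; apply: eq_bigr => f _.
by rewrite prod_letters enumT [index_enum _]unlock.
Qed.

Lemma sym_end_word (n : nat) (s : 'S_n) (c : k) (x : 'I_n -> I) :
  sym_end I (perm_elt k s) << c *g FMonom [seq x i | i <- enum 'I_n] >>
    = << c *g FMonom [seq x (s i) | i <- enum 'I_n] >>.
Proof.
rewrite malgUE [RHS]malgUE linearZ /=; congr (_ *: _).
rewrite /sym_end lin_extU /perm_elt msuppU oner_eq0 big_seq_fset1 mcoeffUU.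
rewrite scale1r /perm_word (_ : insub _ = Some (mktuple x)); last first.
  exact: (valK (mktuple x)).
by congr << FMonom _ >>; apply: eq_map => i; rewrite tnth_mktuple.
Qed.

Lemma comult1 : comult (1 : T) = 1.
Proof. by rewrite /comult lin_extU /comult_word fm1 big_nil. Qed.

Lemma comultM (x y : T) : comult (x * y) = comult x * comult y.
Proof.
rewrite malgME linear_sum [comult x]/lin_ext mulr_suml; apply: eq_bigr => u _.
rewrite linear_sum [comult y]/lin_ext mulr_sumr; apply: eq_bigr => v _.
rewrite (malgUE _ (mmul u v)) linearZ /= /comult lin_extU -malg_scalerAr -scalerAl scalerA.
by rewrite mulrC /comult_word fmM big_cat.
Qed.

Lemma comult_gen (v : {malg k[I]}) :
  comult (gen v) = tens 1 (gen v) + tens (gen v) 1.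
Proof.
have one_word : 1 = << mone >> :> T by [].
have tens1 : tens (1 : T) (gen v) = lin_ext (fun y => << (mone, y) >>) (gen v).
  by rewrite /tens one_word lin_extU.
have E (M : lmodType k) (phi : {fmonom I} -> M) :
    lin_ext phi (gen v) = \sum_(i <- msupp v) v@_i *: phi (fmu i).
  rewrite /gen [lin_ext _ v]/lin_ext linear_sum; apply: eq_bigr => i _.
  by rewrite linearZ /= lin_extU.
rewrite tens1 /tens /comult !E -big_split; apply: eq_bigr => i _ /=.
rewrite -scalerDr; congr (_ *: _); rewrite /comult_word fmU big_seq1.
by rewrite one_word lin_extU.
Qed.

Lemma sym_end_perm (n : nat) (s : 'S_n) (v : 'I_n -> {malg k[I]}) :
  sym_end I (perm_elt k s) (\prod_(i < n) gen (v i))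
    = \prod_(i < n) gen (v (s i)).
Proof.
pose d := (\bigcup_(i <- enum 'I_n) msupp (v i))%fset.
have le i : (msupp (v i) `<=` d)%fset.
  by apply: bigfcup_sup; rewrite ?mem_enum.
rewrite (prod_genE le) (prod_genE (fun i => le (s i))) raddf_sum /=.
rewrite [RHS](reindex (fun f : {ffun 'I_n -> d} => [ffun i => f (s i)])) /=.
  apply: eq_bigr => f _; rewrite sym_end_word.
  rewrite (reindex_inj (@perm_inj _ s)) /=; congr << _ *g FMonom _ >>.
    by apply: eq_map => i; rewrite ffunE.
  by apply: eq_bigr => i _; rewrite ffunE.
exists (fun f : {ffun 'I_n -> d} => [ffun i => f (s^-1 i)%g]) => f _;
  by apply/ffunP => i; rewrite !ffunE ?permK ?permKV.
Qed.

Lemma sym_end_perm0 (m n : nat) (s : 'S_n) (v : 'I_m -> {malg k[I]}) :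
  m != n -> sym_end I (perm_elt k s) (\prod_(i < m) gen (v i)) = 0.
Proof.
move=> mn; pose d := (\bigcup_(i <- enum 'I_m) msupp (v i))%fset.
have le i : (msupp (v i) `<=` d)%fset.
  by apply: bigfcup_sup; rewrite ?mem_enum.
rewrite (prod_genE le) linear_sum big1 //= => f _.
rewrite malgUE linearZ /= /sym_end lin_extU /perm_elt msuppU oner_eq0.
rewrite big_seq_fset1 /perm_word insubN ?scaler0 //.
by rewrite size_map size_enum_ord.
Qed.

Lemma uniq_word (infI : forall s : seq I, exists i, i \notin s) (n : nat) :
  exists t : n.-tuple I, uniq t.
Proof.
elim: n => [|n [t ut]]; first by exists [tuple].
by have [i it] := infI t; exists [tuple of i :: t] => /=; rewrite it.
Qed.

Lemma sym_end_inj (infI : forall s : seq I, exists i, i \notin s)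
    (a b : sym_sum k) : sym_end I a =1 sym_end I b -> a = b.
Proof.
move=> ab; apply/malgP => -[n s].
have [t ut] := uniq_word infI n.
pose w (r : 'S_n) := FMonom [seq tnth t (r i) | i <- enum 'I_n].
suff coef (c : sym_sum k) :
    (sym_end I c << FMonom t >>)@_(w s) = c@_(Tagged (fun n => 'S_n) s).
  by rewrite -!coef ab.
have w_inj : injective w.
  move=> r r' [/eq_in_map rr']; apply/permP => i.
  by apply/(tuple_uniqP _ ut)/rr'; rewrite mem_enum.
have coef1 (m : nat) (r : 'S_m) :
    (perm_word k r (FMonom t))@_(w s)
      = (Tagged (fun n => 'S_n) r == Tagged (fun n => 'S_n) s)%:R.
  have [mn|mn] := eqVneq m n; last first.
    rewrite /perm_word insubN /= ?size_tuple 1?eq_sym // mcoeff0.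
    by case: eqP => // /(congr1 tag) /= nm; rewrite nm eqxx in mn.
  subst m; rewrite /perm_word (_ : insub _ = Some t); last exact: valK.
  by rewrite mcoeffU1 -/(w r) (inj_eq w_inj) eq_Tagged.
rewrite /sym_end lin_extU raddf_sum /=.
rewrite [RHS](_ : _ = \sum_(r <- msupp c)
    c@_r * (r == Tagged (fun n => 'S_n) s)%:R).
  by apply: eq_bigr => -[m r] _; rewrite mcoeffZ coef1.
rewrite {1}(monalgE c) raddf_sum /=; apply: eq_bigr => r _.
by rewrite mcoeffU mulr_natr.
Qed.
End Checks.

Section Descents.
Context (k : fieldType).

(* Elements of [n-1] = {1, ..., n-1} are represented by the nonzero elements  *)
(* of ['I_n]; the positions [i] and [i + 1], counted from 1, are the          *)
(* ordinals of value [i - 1] and [i].                                         *)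
Definition Des (n : nat) (s : 'S_n) : {set 'I_n} :=
  [set i : 'I_n | [exists j : 'I_n, (j.+1 == i) && (s i < s j)%N]].

Definition descent_sum (n : nat) (J : {set 'I_n}) : sym_sum k :=
  \sum_(s : 'S_n | Des s \subset J) perm_elt k s.

Definition is_composition (n : nat) (al : seq nat) : bool :=
  all (leq 1) al && (sumn al == n).

Definition composition_set (n : nat) (al : seq nat) : {set 'I_n} :=
  [set i : 'I_n |
     nat_of_ord i \in [seq sumn (take j al) | j <- iota 1 (size al).-1]].

Definition X (n : nat) (al : seq nat) : sym_sum k :=
  descent_sum (composition_set n al).

Definition span (M : lmodType k) (P : M -> Prop) (x : M) : Prop :=
  exists2 s : seq (k * M), (forall p, p \in s -> P p.2)
                         & x = \sum_(p <- s) p.1 *: p.2.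

Definition Sigma_ (n : nat) : sym_sum k -> Prop :=
  span (fun x => exists2 al, is_composition n al & x = X n al).

Definition Sigma (x : sym_sum k) : Prop :=
  exists N (y : nat -> sym_sum k),
    (forall n, Sigma_ n (y n)) /\ x = \sum_(n < N) y n.
End Descents.

(* Main.v *)
(* On a word w, X_(a_1, ..., a_r) is the sum of the concatenations             *)
(* w_{S_1} ... w_{S_r} over the ordered set partitions (S_1, ..., S_r) of the  *)
(* positions with |S_i| = a_i.  In X_al # X_be one splits w into w_U and the   *)
(* w_{S_i}, then each S_i into A_i and B_i, and applies X_be to                *)
(* w_U w_{A_1} ... w_{A_r}, which cuts U and the A_i again into s parts each.  *)
(* The outcome is the sum of all concatenations of r + s (r + 1) disjoint      *)
(* subwords, listed as the B_i followed by an s x (r + 1) matrix read row by   *)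
(* row, whose sizes have prescribed sums; so X_al # X_be is the sum of X_ga    *)
(* over finitely many ga, after deletion of the zero entries of ga.            *)

Require Import Defs.
From HB Require Import structures.
From mathcomp Require Import all_boot all_order all_fingroup all_algebra.
From mathcomp Require Import finmap.
From mathcomp.multinomials Require Import xfinmap monalg.

Set Implicit Arguments.
Unset Strict Implicit.
Unset Printing Implicit Defensive.
Import GRing.Theory.
Local Open Scope ring_scope.

(** By bilinearity it is enough to write the smash product of [X al] and [X be] as a sum of elements
    [X ga], and two linear maps on $T(V)$ agree once they agree on words. On a word, [X al] acts as
    an iterated unshuffle coproduct whose components have the degrees listed in [al], followed by
    multiplication ([sym_end_X]), and [smash_word] unfolds the smash product in the same terms. So
    everything is built from coproduct and product. Coassociativity ([big_splitsA]), cocommutativity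
    ([big_splitsC]) and multiplicativity of the coproduct ([big_splits_cat]) turn the composite into
    a single iterated coproduct followed by a single product, with conditions on the degrees of the
    components: this is [big_rsplits_smash], a relative of Solomon's Mackey formula.

    Collecting its terms by their degrees yields the [X ga] ([smash_XX]). The conditions bound the
    degrees ([sumn_smash]), so finitely many [ga] occur, independently of the word. By [sym_end_inj]
    the element [c] found in this way is the only one that acts as the smash product. *)

Definition add_seq (s t : seq nat) : seq nat := [seq (p.1 + p.2)%N | p <- zip s t].

(* Row and column sums of a matrix with [s] rows of length [r], read row by row. *)
Fixpoint row_sums (r s : nat) (ns : seq nat) : seq nat :=
  if s is s'.+1 then sumn (take r ns) :: row_sums r s' (drop r ns) else [::].

Fixpoint col_sums (r s : nat) (ns : seq nat) : seq nat :=
  if s is s'.+1 then add_seq (take r ns) (col_sums r s' (drop r ns))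
  else nseq r 0%N.

(* The first [r] entries are the sizes of the parts of the [r] blocks of the   *)
(* left factor on which the right factor does not act; the remaining ones are *)
(* an [s] by [r.+1] matrix whose rows make up the blocks of the right factor, *)
(* with column [0] coming from the letters on which the left factor does not  *)
(* act.                                                                       *)
Definition smash_left (r s : nat) (ns : seq nat) : seq nat :=
  add_seq (behead (col_sums r.+1 s (drop r ns))) (take r ns).
Definition smash_right (r s : nat) (ns : seq nat) : seq nat :=
  row_sums r.+1 s (drop r ns).

(** * Iterated unshuffle coproducts of words, as sums over splittings *)

Section Splittings.
Variable A : eqType.
Implicit Types (u v w : seq A).

(** These pairs are the terms of the coproduct of [w], one for each set of positions and hence with
    multiplicity when letters repeat. *)
Fixpoint splits w : seq (seq A * seq A) :=
  if w is x :: w' then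
    [seq (x :: p.1, p.2) | p <- splits w'] ++
    [seq (p.1, x :: p.2) | p <- splits w']
  else [:: ([::], [::])].

(** The terms of the coproduct iterated to [r] factors. Parts may be empty, and [r = 0] is the
    counit: it kills nonempty words. *)
Fixpoint rsplits r w : seq (seq (seq A)) :=
  if r is r'.+1 then [seq p.1 :: us | p <- splits w, us <- rsplits r' p.2]
  else if nilp w then [:: [::]] else [::].

Lemma size_rsplits r w us : us \in rsplits r w -> size us = r.
Proof.
elim: r w us => [|r IH] w us /=; first by case: nilp; rewrite // inE => /eqP ->.
by case/allpairsPdep => p [vs [_ vsP ->]]; rewrite /= (IH _ _ vsP).
Qed.

Lemma perm_splits w p : p \in splits w -> perm_eq (p.1 ++ p.2) w.
Proof.
elim: w p => [|x w IH] p /=; first by rewrite inE => /eqP ->.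
rewrite mem_cat => /orP[] /mapP[q /IH qP ->] /=; first by rewrite perm_cons.
by rewrite -cat1s perm_catCA /= perm_cons.
Qed.

Section Sums.
Variable V : nmodType.

Lemma big_splits_cons x w (F : seq A * seq A -> V) :
  \sum_(p <- splits (x :: w)) F p =
  \sum_(p <- splits w) (F (x :: p.1, p.2) + F (p.1, x :: p.2)).
Proof. by rewrite /= big_cat !big_map big_split. Qed.

(** The coproduct is multiplicative. *)
Lemma big_splits_cat u v (F : seq A * seq A -> V) :
  \sum_(p <- splits (u ++ v)) F p =
  \sum_(p <- splits u) \sum_(q <- splits v) F (p.1 ++ q.1, p.2 ++ q.2).
Proof.
elim: u F => [|x u IH] F; first by rewrite /= big_seq1; apply: eq_bigr => -[].
by rewrite !big_splits_cons IH; apply: eq_bigr => p _; rewrite -big_split.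
Qed.

Lemma big_splits_nil w (F : seq A * seq A -> V) :
  \sum_(p <- splits w | nilp p.1) F p = F ([::], w).
Proof.
rewrite big_mkcond; elim: w F => [|x w IH] F; first by rewrite /= big_seq1.
rewrite big_splits_cons /= -[RHS](IH (fun p => F (p.1, x :: p.2))).
by apply: eq_bigr => p _; rewrite add0r.
Qed.

(** Coassociativity: on either side each letter chooses freely among three places. *)
Lemma big_splitsA w (F : seq A -> seq A -> seq A -> V) :
  \sum_(p <- splits w) \sum_(q <- splits p.1) F q.1 q.2 p.2 =
  \sum_(p <- splits w) \sum_(q <- splits p.2) F p.1 q.1 q.2.
Proof.
elim: w F => [|x w IH] F; first by do !rewrite /= big_seq1.
rewrite !big_splits_cons /=.
under eq_bigr do rewrite big_splits_cons /= -big_split /=.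
under [RHS]eq_bigr do rewrite big_splits_cons /= -big_split /=.
rewrite (IH (fun a b c => F (x :: a) b c + F a (x :: b) c + F a b (x :: c))).
by apply: eq_bigr => p _; apply: eq_bigr => q _; rewrite addrA.
Qed.

(** Each letter chooses freely among four places, so the two middle ones may be swapped. *)
Lemma big_splits_interchange w (F : seq A -> seq A -> seq A -> seq A -> V) :
  \sum_(p <- splits w) \sum_(q <- splits p.1) \sum_(r <- splits p.2)
    F q.1 q.2 r.1 r.2 =
  \sum_(p <- splits w) \sum_(q <- splits p.1) \sum_(r <- splits p.2)
    F q.1 r.1 q.2 r.2.
Proof.
elim: w F => [|x w IH] F; first by do !rewrite /= big_seq1.
rewrite !big_splits_cons /=.
pose G a b c d := F (x :: a) b c d + F a (x :: b) c d +
  (F a b (x :: c) d + F a b c (x :: d)).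
transitivity (\sum_(p <- splits w) \sum_(q <- splits p.1) \sum_(r <- splits p.2)
    G q.1 q.2 r.1 r.2).
  apply: eq_bigr => p _; rewrite big_splits_cons /= -big_split; apply: eq_bigr => q _ /=.
  by rewrite big_splits_cons -!big_split.
rewrite IH; apply: eq_bigr => p _; rewrite big_splits_cons /= -big_split.
apply: eq_bigr => q _ /=; rewrite big_splits_cons -!big_split.
by apply: eq_bigr => r _; rewrite /G /= addrACA.
Qed.

Lemma big_rsplits0 w (F : seq (seq A) -> V) :
  \sum_(us <- rsplits 0 w) F us = if nilp w then F [::] else 0.
Proof. by rewrite /=; case: nilp; rewrite ?big_seq1 ?big_nil. Qed.

Lemma big_rsplitsS r w (F : seq (seq A) -> V) :
  \sum_(us <- rsplits r.+1 w) F us =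
  \sum_(p <- splits w) \sum_(us <- rsplits r p.2) F (p.1 :: us).
Proof. by rewrite /= big_allpairs_dep. Qed.

Lemma big_rsplitsD r s w (F : seq (seq A) -> V) :
  \sum_(us <- rsplits (r + s) w) F us =
  \sum_(p <- splits w) \sum_(us <- rsplits r p.1) \sum_(vs <- rsplits s p.2)
    F (us ++ vs).
Proof.
elim: r w F => [|r IH] w F.
  under [RHS]eq_bigr do rewrite big_rsplits0 /=.
  rewrite -big_mkcond /= (big_splits_nil _ (fun p => \sum_(vs <- rsplits s p.2) F vs)).
  by [].
rewrite addSn big_rsplitsS.
under eq_bigr do rewrite IH.
under [RHS]eq_bigr do rewrite big_rsplitsS.
by rewrite (big_splitsA _ (fun a b c => \sum_(us <- rsplits r b)
  \sum_(vs <- rsplits s c) F ((a :: us) ++ vs))).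
Qed.

(** Cutting each of [r] blocks in two is the same as cutting [w] in two first and then each half
    into [r] blocks; the block sizes add up. *)
Lemma big_splits_flatten r w (F : seq nat -> seq A -> seq A -> V) :
  \sum_(us <- rsplits r w) \sum_(p <- splits (flatten us))
    F (map size us) p.1 p.2 =
  \sum_(p <- splits w) \sum_(us <- rsplits r p.1) \sum_(vs <- rsplits r p.2)
    F (add_seq (map size us) (map size vs))
      (flatten us) (flatten vs).
Proof.
elim: r w F => [|r IH] w F.
  under [RHS]eq_bigr do rewrite big_rsplits0 /=.
  rewrite -big_mkcond /= (big_splits_nil _ (fun p => \sum_(vs <- rsplits 0 p.2) _)).
  by rewrite !big_rsplits0 /= big_seq1.
rewrite big_rsplitsS.
transitivity (\sum_(p <- splits w) \sum_(q <- splits p.1)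
  \sum_(r0 <- splits p.2) \sum_(us <- rsplits r r0.1) \sum_(vs <- rsplits r r0.2)
   F ((size q.1 + size q.2)%N :: (add_seq (map size us) (map size vs)))
     (q.1 ++ flatten us) (q.2 ++ flatten vs)).
  apply: eq_bigr => p _ /=.
  under eq_bigr do rewrite big_splits_cat.
  rewrite exchange_big /=; apply: eq_big_seq => q qP.
  rewrite (IH _ (fun ns u v => F (size p.1 :: ns) (q.1 ++ u) (q.2 ++ v))).
  by rewrite -(perm_size (perm_splits qP)) size_cat.
rewrite (big_splits_interchange _ (fun a b c d =>
   \sum_(us <- rsplits r c) \sum_(vs <- rsplits r d)
   F ((size a + size b)%N :: (add_seq (map size us) (map size vs)))
     (a ++ flatten us) (b ++ flatten vs))).
apply: eq_bigr => p _; rewrite big_rsplitsS; apply: eq_bigr => q _.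
by rewrite exchange_big; apply: eq_bigr => us _; rewrite big_rsplitsS.
Qed.

Lemma big_rsplits_nil r w (F : seq nat -> V) :
  \sum_(us <- rsplits r w) (if nilp (flatten us) then F (map size us) else 0) =
  if nilp w then F (nseq r 0%N) else 0.
Proof.
elim: r w F => [|r IH] w F; first by rewrite big_rsplits0.
rewrite big_rsplitsS.
transitivity (\sum_(p <- splits w | nilp p.1) \sum_(us <- rsplits r p.2)
    if nilp (flatten us) then F (0%N :: map size us) else 0).
  rewrite [RHS]big_mkcond; apply: eq_bigr => -[[|x u] v] _ //=.
  by rewrite big1.
rewrite (big_splits_nil _ (fun p => \sum_(us <- rsplits r p.2) _)).
exact: (IH w (fun ns => F (0%N :: ns))).
Qed.

(** Cutting into [r] blocks and then cutting their concatenation into [s] pieces amounts to choosing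
    an [s] by [r] matrix of subwords: blocks are its columns, pieces its rows. The induction removes
    one row at a time by [big_splits_flatten]. *)
Lemma big_rsplits_flatten r s w (F : seq nat -> seq nat -> seq A -> V) :
  \sum_(us <- rsplits r w) \sum_(vs <- rsplits s (flatten us))
    F (map size us) (map size vs) (flatten vs) =
  \sum_(us <- rsplits (s * r) w)
    F (col_sums r s (map size us)) (row_sums r s (map size us)) (flatten us).
Proof.
elim: s w F => [|s IH] w F.
  under eq_bigr do rewrite big_rsplits0 /=.
  by rewrite mul0n big_rsplits0 /= (big_rsplits_nil _ _ (fun ns => F ns [::] [::])).
rewrite mulSn big_rsplitsD.
under eq_bigr do rewrite big_rsplitsS.
rewrite (big_splits_flatten _ _ (fun ns u v => \sum_(vs <- rsplits s v)
  F ns (size u :: map size vs) (u ++ flatten vs))).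
apply: eq_bigr => p _; apply: eq_big_seq => us /size_rsplits sz_us.
rewrite (IH _ (fun ns ms v => F (add_seq (map size us) ns)
   (size (flatten us) :: ms) (flatten us ++ v))).
apply: eq_bigr => vs _ /=.
by rewrite map_cat take_size_cat ?drop_size_cat ?size_map // flatten_cat size_flatten.
Qed.
Lemma big_splitsC w (F : seq A -> seq A -> V) :
  \sum_(p <- splits w) F p.1 p.2 = \sum_(p <- splits w) F p.2 p.1.
Proof.
elim: w F => [|x w IH] F; first by rewrite /= !big_seq1.
rewrite !big_splits_cons (IH (fun u v => F (x :: u) v + F u (x :: v))).
by apply: eq_bigr => p _; rewrite addrC.
Qed.

(** The left side is the smash product on words with the degree conditions left to [F]: [p.2] is the
    part missed by the left factor, and [q.2] the part missed by the right one. *)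
Lemma big_rsplits_smash r s w (F : seq nat -> seq nat -> seq A -> V) :
  \sum_(p <- splits w) \sum_(us <- rsplits r p.1) \sum_(q <- splits (flatten us))
    \sum_(vs <- rsplits s (p.2 ++ q.1))
      F (map size us) (map size vs) (q.2 ++ flatten vs) =
  \sum_(us <- rsplits (r + s * r.+1) w)
    F (smash_left r s (map size us)) (smash_right r s (map size us)) (flatten us).
Proof.
(* Here [a] and [b] collect the halves of the blocks that the right factor does and does not see,
   and [c] is the part missed by the left factor. *)
pose G (a b c : seq A) := \sum_(us <- rsplits r a) \sum_(us' <- rsplits r b)
  \sum_(vs <- rsplits s (c ++ flatten us))
  F (add_seq (map size us) (map size us')) (map size vs) (flatten us' ++ flatten vs).
transitivity (\sum_(p <- splits w) \sum_(q <- splits p.1) G q.1 q.2 p.2).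
  apply: eq_bigr => p _; exact: (big_splits_flatten _ _ (fun ns u v =>
    \sum_(vs <- rsplits s (p.2 ++ u)) F ns (map size vs) (v ++ flatten vs))).
(* The three parts are reordered as [b], [c], [a], so that [c] and the [r] subwords of [a] form one
   splitting into [r.+1] blocks, with [c] as column 0. *)
rewrite big_splitsA (big_splitsC _ (fun x y => \sum_(q <- splits y) G x q.1 q.2)).
rewrite (big_splitsA _ (fun b c a => G a b c)) big_rsplitsD.
apply: eq_bigr => p _.
under eq_bigr do rewrite /G exchange_big.
rewrite exchange_big; apply: eq_big_seq => us /size_rsplits sz_us.
transitivity (\sum_(us0 <- rsplits r.+1 p.2) \sum_(vs <- rsplits s (flatten us0))
  F (add_seq (behead (map size us0)) (map size us)) (map size vs)
    (flatten us ++ flatten vs)).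
  by rewrite big_rsplitsS.
rewrite (big_rsplits_flatten r.+1 s p.2 (fun ns ms v =>
  F (add_seq (behead ns) (map size us)) ms (flatten us ++ v))).
apply: eq_bigr => vs _; rewrite /smash_left /smash_right.
by rewrite map_cat take_size_cat ?drop_size_cat ?size_map // flatten_cat.
Qed.

End Sums.
End Splittings.

(** * Splittings with prescribed sizes, and their description by descents *)

Section Unshuffles.
Variable A : eqType.
Implicit Types (u v w : seq A) (al : seq nat).

Fixpoint unshuffles al w : seq (seq A) :=
  if al is a :: al' then
    [seq p.1 ++ v | p <- [seq p <- splits w | size p.1 == a], v <- unshuffles al' p.2]
  else if nilp w then [:: [::]] else [::].

Lemma big_unshuffles (V : nmodType) al w (F : seq A -> V) :
  \sum_(u <- unshuffles al w) F u =
  \sum_(us <- rsplits (size al) w | map size us == al) F (flatten us).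
Proof.
elim: al w F => [|a al IH] w F.
  by rewrite [RHS]big_mkcond big_rsplits0 /=; case: nilp; rewrite ?big_seq1 ?big_nil.
rewrite big_allpairs_dep big_filter [LHS]big_mkcond [RHS]big_mkcond big_rsplitsS.
apply: eq_bigr => p _; case: eqP => [<-|/eqP/negPf pa] /=; last first.
  by rewrite big1 // => us _; rewrite eqseq_cons pa.
rewrite IH big_mkcond; apply: eq_bigr => us _.
by rewrite eqseq_cons eqxx.
Qed.

(** A zero entry forces an empty part, which leaves the concatenation unchanged; this turns size
    vectors into compositions. *)
Lemma big_unshuffles_pos (V : nmodType) al w (F : seq A -> V) :
  \sum_(u <- unshuffles [seq a <- al | 0 < a]%N w) F u =
  \sum_(u <- unshuffles al w) F u.
Proof.
elim: al w F => [|[|a] al IH] w F //=.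
  rewrite IH big_allpairs_dep big_filter.
  by rewrite (big_splits_nil _ (fun p => \sum_(v <- unshuffles al p.2) F (p.1 ++ v))).
by rewrite !big_allpairs_dep; apply: eq_bigr => p _; rewrite IH.
Qed.

Lemma splits_complement w p : uniq w -> p \in splits w ->
  [/\ p.1 = [seq x <- w | x \in p.1], p.2 = [seq x <- w | x \notin p.1]
    & uniq p.2].
Proof.
move=> uw pw; have [sub1 sub2] : subseq p.1 w /\ subseq p.2 w.
  elim: w p pw {uw} => [|x w IH] p /=; first by rewrite inE => /eqP ->.
  rewrite mem_cat => /orP[] /mapP[q /IH[s1 s2] ->] /=; rewrite eqxx;
    by split=> //; apply: subseq_trans (subseq_cons _ _).
have pp := perm_splits pw; have := uw; rewrite -(perm_uniq pp) cat_uniq.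
case/and3P => u1 /hasPn dis u2; split=> //; first exact/subseq_uniqP.
rewrite {1}(subseq_uniqP uw sub2); apply: eq_in_filter => x xw.
have := xw; rewrite -(perm_mem pp) mem_cat; case: (boolP (x \in p.2)).
  by move=> /dis /= ->.
by rewrite orbF => _ ->.
Qed.

Lemma filter_splits (P : pred A) w :
  (filter P w, filter (predC P) w) \in splits w.
Proof.
elim: w => //= x w IH; rewrite mem_cat; case: (P x) => /=.
  by apply/orP; left; apply/mapP; exists (filter P w, filter (predC P) w).
by apply/orP; right; apply/mapP; exists (filter P w, filter (predC P) w).
Qed.

Lemma uniq_splits w : uniq w -> uniq (splits w).
Proof.
elim: w => //= x w IH /andP[xw uw]; rewrite cat_uniq !map_inj_uniq ?IH //=.
- rewrite andbT; apply/hasPn => _ /mapP[p /perm_splits pp ->].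
  apply/negP => /mapP[q _ [xp _]]; case/negP: xw.
  by rewrite -(perm_mem pp) xp mem_cat mem_head.
- by move=> [? ?] [? ?] [-> ->].
- by move=> [? ?] [? ?] [-> ->].
Qed.

(** The prescribed sizes recover the parts from their concatenation, and in a word without
    repetition a part determines its positions. *)
Lemma uniq_unshuffles al w : uniq w -> uniq (unshuffles al w).
Proof.
elim: al w => [|a al IH] w uw /=; first by case: nilp.
apply: allpairs_uniq_dep; first exact/filter_uniq/uniq_splits.
  by move=> p; rewrite mem_filter => /andP[_ /(splits_complement uw)[_ _ /IH]].
move=> _ _ /allpairsPdep[p [u [pw _ ->]]] /allpairsPdep[q [v [qw _ ->]]] /= /eqP.
move: pw qw; rewrite !mem_filter => /andP[/eqP sp pw] /andP[/eqP sq qw].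
rewrite eqseq_cat ?sp ?sq // => /andP[/eqP pq1 /eqP ->].
suff -> : p = q by [].
case: p q {sp sq} pw qw pq1 => [p1 p2] [q1 q2] /= pw qw pq1.
have [_ /= -> _] := splits_complement uw pw; have [_ /= -> _] := splits_complement uw qw.
by rewrite pq1.
Qed.

Lemma size_unshuffles al w u :
  u \in unshuffles al w -> perm_eq u w /\ size w = sumn al.
Proof.
elim: al w u => [|a al IH] w u /=.
  by case: w => // /[!inE] /eqP ->.
case/allpairsPdep => p [v [+ vp ->]]; rewrite mem_filter => /andP[/eqP sp pw].
have [pv sz] := IH _ _ vp; have pp := perm_splits pw; split.
  by apply: perm_trans pp; rewrite perm_cat2l.
by rewrite -(perm_size pp) size_cat sp sz.
Qed.

Section Sorted.
Variable leT : rel A.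
Hypotheses (leT_tr : transitive leT) (leT_asym : antisymmetric leT).

Fixpoint block_sorted al u : bool :=
  if al is a :: al' then
    [&& a <= size u, sorted leT (take a u) & block_sorted al' (drop a u)]%N
  else nilp u.

(** A subword of a sorted word is sorted, and conversely a sorted arrangement of some of its letters
    is the subword on those letters. *)
Lemma mem_unshuffles al w u : uniq w -> sorted leT w ->
  (u \in unshuffles al w) = perm_eq u w && block_sorted al u.
Proof.
elim: al w u => [|a al IH] w u uw sw /=.
  case: w uw sw => [|x w] _ _; case: u => [|y u]; rewrite /= ?andbF //.
  by apply/esym/andP => -[/perm_size].
apply/allpairsPdep/andP => [[p [v [+ vp ->]]]|[puw /and3P[au su bu]]].
  rewrite mem_filter => /andP[/eqP sp pw]; have [e1 e2 up2] := splits_complement uw pw.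
  have sp2 : sorted leT p.2 by rewrite e2 sorted_filter.
  move: vp; rewrite IH // => /andP[pv bv]; split.
    by apply: perm_trans (perm_splits pw); rewrite perm_cat2l.
  rewrite size_cat sp leq_addr take_size_cat // drop_size_cat // bv andbT /=.
  by rewrite e1 sorted_filter.
have uu : uniq u by rewrite (perm_uniq puw).
have := uu; rewrite -{1}(cat_take_drop a u) cat_uniq => /and3P[ut dis ud].
(* The first part must be the subword of [w] on the letters of the first block of [u]; the rest of
   [u] rearranges the complement. *)
pose P x := x \in take a u.
have eP : take a u = filter P w.
  apply: (sorted_eq leT_tr leT_asym su); first exact: sorted_filter.
  apply: uniq_perm => //; first exact: filter_uniq.
  move=> x; rewrite mem_filter /P -(perm_mem puw) andb_idr // => /mem_take.
  by [].
have eQ : perm_eq (drop a u) (filter (predC P) w).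
  apply: uniq_perm => //; first exact: filter_uniq.
  move=> x; rewrite mem_filter /= /P -(perm_mem puw).
  rewrite -[in RHS](cat_take_drop a u) mem_cat cat_take_drop.
  case: (boolP (x \in take a u)) => //= xt; apply/negP => xd.
  by case/hasP: dis; exists x.
exists (filter P w, filter (predC P) w), (drop a u); split.
- by rewrite mem_filter filter_splits -eP size_takel ?eqxx.
- by rewrite IH ?eQ ?filter_uniq ?sorted_filter.
- by rewrite -eP cat_take_drop.
Qed.

(** Counting from 0, a block boundary separates entries [i] and [i.+1] exactly when [i.+1] is a
    partial sum of [al]. *)
Lemma block_sortedP (x0 : A) al u :
  reflect (size u = sumn al /\ forall i, (i.+1 < size u)%N ->
             (forall j, i.+1 != sumn (take j al)) ->
             leT (nth x0 u i) (nth x0 u i.+1))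
    (block_sorted al u).
Proof.
apply: (iffP idP).
  elim: al u => [|a al IH] u /=; first by case: u.
  case/and3P => au su /IH[sz H]; split.
    by rewrite -sz size_drop subnKC.
  move=> i iu nj; case: (ltngtP i.+1 a) => ia; last first.
  - by have := nj 1%N; rewrite /= take0 addn0 ia eqxx.
  - rewrite ltnS in ia; move: iu nj; rewrite -(subnKC ia).
    move: (i - a)%N => d iu nj; rewrite -addnS -!nth_drop; apply: H.
      by rewrite size_drop ltn_subRL addnS.
    by move=> j; have := nj j.+1; rewrite /= -addnS eqn_add2l.
  - move/(sortedP x0): su => /(_ i); rewrite size_takel // ia.
    rewrite !nth_take //; last exact: ltnW.
    exact.
elim: al u => [|a al IH] u /= [sz H]; first by case: u sz {H}.
have au : (a <= size u)%N by rewrite sz leq_addr.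
apply/and3P; split=> //.
  apply/(sortedP x0) => i; rewrite size_takel // => ia.
  rewrite !nth_take //; last exact: ltnW.
  apply: H; first exact: leq_trans ia au.
  case=> [|j] //=; apply/eqP => e; move: ia; rewrite e.
  by rewrite ltnNge leq_addr.
apply: IH; split; first by rewrite size_drop sz addKn.
move=> i; rewrite size_drop ltn_subRL addnS => iu nj; rewrite !nth_drop addnS.
apply: H => // -[|j] //=; rewrite -addnS eqn_add2l; exact: nj.
Qed.
End Sorted.
End Unshuffles.

Lemma splits_map (A B : eqType) (f : A -> B) w :
  splits (map f w) = [seq (map f p.1, map f p.2) | p <- splits w].
Proof. by elim: w => //= x w ->; rewrite map_cat -!map_comp. Qed.

Lemma big_unshuffles_map (A B : eqType) (f : A -> B) (V : nmodType) al w
    (F : seq B -> V) :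
  \sum_(u <- unshuffles al (map f w)) F u =
  \sum_(u <- unshuffles al w) F (map f u).
Proof.
elim: al w F => [|a al IH] w F /=; first by case: w => [|x w]; rewrite ?big_seq1 ?big_nil.
rewrite !big_allpairs_dep !big_filter splits_map big_map /=.
under eq_bigl do rewrite size_map.
apply: eq_bigr => p _; rewrite IH; apply: eq_bigr => v _.
by rewrite map_cat.
Qed.

(** * The action of [X al] on words *)

Section Action.
Variables (k : fieldType) (I : choiceType).
Local Notation T := {malg k[{fmonom I}]}.

Definition unshuffle_sum al (w : seq I) : T :=
  \sum_(u <- unshuffles al w) << FMonom u >>.

Definition perm_seq n (s : 'S_n) : seq 'I_n := [seq s i | i <- enum 'I_n].

Lemma perm_seq_inj n : injective (@perm_seq n).
Proof.
by move=> s t /eq_in_map st; apply/permP => i; apply: st; rewrite mem_enum.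
Qed.

(** The implication is there because the ordinal 0 is always a partial sum, although it stands for
    no element of $[n-1]$. Zero entries in [al] are allowed. *)
Lemma mem_composition_set n al (i : 'I_n) : sumn al = n ->
  reflect (exists j, i = sumn (take j al) :> nat)
    ((0 < i)%N ==> (i \in composition_set n al)).
Proof.
move=> sn; apply: (iffP idP).
  case: (posnP i) => [-> _|_ /=]; first by exists 0%N; rewrite take0.
  by rewrite inE => /mapP[j _ ->]; exists j.
case=> j ij; apply/implyP => i0; rewrite inE; apply/mapP; exists j => //.
rewrite mem_iota; case: j ij => [|j] ij; first by rewrite ij take0 in i0.
rewrite add1n /=; case: (ltnP j.+1 (size al)) => [|jal].
  by case: (size al).
by move: (ltn_ord i); rewrite ij take_oversize // sn ltnn.
Qed.

Lemma block_sorted_perm_seq n al (s : 'S_n) : sumn al = n ->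
  block_sorted (relpre (@nat_of_ord n) leq) al (perm_seq s) =
  (Des s \subset composition_set n al).
Proof.
(* ['I_0] has no default element for [nth]; for [n = 0] both sides are true. *)
case: n s => [|n] s sn.
  have -> : perm_seq s = [::] by apply: size0nil; rewrite size_map size_enum_ord.
  transitivity true; last by apply/esym/subsetP => -[].
  by elim: al sn => [|[|a] al IH] //= sal; rewrite IH.
have nthE i : (i < n.+1)%N -> nth ord0 (perm_seq s) i = s (inord i).
  move=> ilt; rewrite (nth_map ord0) ?size_enum_ord //; congr (s _).
  by apply: val_inj; rewrite /= nth_enum_ord // inordK.
have sz : size (perm_seq s) = n.+1 by rewrite size_map size_enum_ord.
apply/(block_sortedP _ ord0)/subsetP => [[_ H] i|H].
  rewrite inE => /existsP[j /andP[/eqP ji sij]].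
  move/(mem_composition_set i): sn; rewrite -ji /=; case=> // nj.
  have := H j; rewrite sz ji ltn_ord !nthE // !inord_val -ji /= leqNgt sij => /(_ isT) F.
  by suff: ~~ true by []; apply: F => l; apply/eqP => e; apply: nj; exists l.
split=> [|i]; first by rewrite sz.
rewrite sz => ilt nj; have ilt' := ltnW ilt; rewrite !nthE //= leqNgt.
apply/negP => sij; have /H : inord i.+1 \in Des s.
  by rewrite inE; apply/existsP; exists (inord i); rewrite !inordK ?eqxx.
move=> cs; have /(mem_composition_set (inord i.+1)) := sn.
rewrite cs implybT => /elimT/(_ isT)[j]; rewrite inordK // => e.
by have := nj j; rewrite -e eqxx.
Qed.

(** On the word of positions, which is sorted and has no repetition, unshuffles are the one-line
    notations of the permutations summed in [X]. *)
Lemma perm_unshuffles_enum n al : sumn al = n ->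
  perm_eq (unshuffles al (enum 'I_n))
    [seq perm_seq s | s <- enum [set s : 'S_n | Des s \subset composition_set n al]].
Proof.
move=> sn; apply: uniq_perm.
- exact/uniq_unshuffles/enum_uniq.
- by rewrite map_inj_uniq ?enum_uniq //; apply: perm_seq_inj.
move=> u; rewrite (mem_unshuffles (leT := relpre (@nat_of_ord n) leq)) ?enum_uniq //.
- apply/andP/mapP => [[pu bu]|[s + ->]].
    have szu : size u == n by rewrite (perm_size pu) size_enum_ord.
    have uu : uniq (Tuple szu) by rewrite /= (perm_uniq pu) enum_uniq.
    have tinj : injective (tnth (Tuple szu)) by apply/tuple_uniqP.
    have eu : u = perm_seq (perm tinj).
      rewrite -[LHS](map_tnth_enum (Tuple szu)).
      by apply: eq_map => i; rewrite permE.
    exists (perm tinj) => //.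
    by rewrite mem_enum inE -block_sorted_perm_seq // -eu.
  rewrite mem_enum inE -block_sorted_perm_seq // => ->; split=> //.
  apply: uniq_perm; rewrite ?enum_uniq //.
    by rewrite map_inj_uniq ?enum_uniq //; apply: perm_inj.
  move=> i; rewrite mem_enum; apply/mapP; exists (s^-1 i)%g; rewrite ?mem_enum //.
  by rewrite permKV.
- by move=> x y z; apply: leq_trans.
- by move=> x y; rewrite -eqn_leq => /eqP/val_inj.
- by rewrite -sorted_map val_enum_ord iota_sorted.
Qed.

(** The case of the word of positions transfers to any word of length [n] by relabelling; on other
    lengths both sides vanish. *)
Lemma sym_end_X n al (w : seq I) : sumn al = n ->
  sym_end I (X k n al) << FMonom w >> = unshuffle_sum al w.
Proof.
move=> sn; rewrite /sym_end lin_extU.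
transitivity (\sum_(s : 'S_n | Des s \subset composition_set n al)
    perm_word k s (FMonom w)).
  rewrite -[LHS]/(lin_ext (fun s => perm_word k (tagged s) (FMonom w)) (X k n al)).
  rewrite /X /descent_sum linear_sum; apply: eq_bigr => s _ /=.
  by rewrite /perm_elt lin_extU.
rewrite /unshuffle_sum; have [sw|sw] := eqVneq (size w) n; last first.
  rewrite big1 => [|s _]; last by rewrite /perm_word insubN.
  rewrite big_seq big1 // => u /size_unshuffles[_].
  by rewrite sn => /eqP; rewrite (negPf sw).
pose t := tcast sw (in_tuple w).
have wt : w = tval t by rewrite /t val_tcast.
rewrite {2}wt -(map_tnth_enum t) big_unshuffles_map.
rewrite (perm_big _ (perm_unshuffles_enum sn)).
rewrite big_map big_enum /=; apply: eq_big => [s|s _]; first by rewrite inE.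
rewrite /perm_word (_ : insub _ = Some t); last by rewrite /= wt valK.
by rewrite /perm_seq enumT -!map_comp.
Qed.
End Action.

(** * The coproduct and the smash product evaluated on words *)

Lemma linear_lin_ext (k : fieldType) (K : choiceType) (M N : lmodType k)
    (L : {linear M -> N}) (phi : K -> M) (a : {malg k[K]}) :
  L (lin_ext phi a) = lin_ext (fun x => L (phi x)) a.
Proof. by rewrite linear_sum; apply: eq_bigr => x _; rewrite linearZ. Qed.

Lemma eq_lin_ext (k : fieldType) (K : choiceType) (M : lmodType k)
    (phi psi : K -> M) : phi =1 psi -> lin_ext phi =1 lin_ext psi.
Proof. by move=> e a; apply: eq_bigr => x _; rewrite e. Qed.

Lemma malgUM (k : fieldType) (K : monomType) (x y : K) :
  << x >> * << y >> = << mmul x y >> :> {malg k[K]}.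
Proof. by rewrite malgM_def fgmulUU mulr1. Qed.

Section SmashWords.
Variables (k : fieldType) (I : choiceType).
Local Notation T := {malg k[{fmonom I}]}.
Local Notation T2 := {malg k[({fmonom I} * {fmonom I})%type]}.

Lemma mmul_FMonom (u v : seq I) : mmul (FMonom u) (FMonom v) = FMonom (u ++ v).
Proof. by apply: val_inj; rewrite /= fmM. Qed.

Lemma malgUM2 (u v u' v' : seq I) :
  << (FMonom u, FMonom v) >> * << (FMonom u', FMonom v') >> =
  << (FMonom (u ++ u'), FMonom (v ++ v')) >> :> T2.
Proof.
rewrite (malgUM k (FMonom u, FMonom v)) -!mmul_FMonom.
exact: erefl.
Qed.

Lemma comultE (w : seq I) :
  comult << FMonom w >> =
  \sum_(p <- splits w) << (FMonom p.1, FMonom p.2) >> :> T2.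
Proof.
rewrite /comult lin_extU /comult_word /=.
have one_word : mone = FMonom [::] :> {fmonom I} by apply: val_inj; rewrite /= fm1.
elim: w => [|x w IH]; first by rewrite big_nil big_seq1 -one_word.
rewrite big_cons IH big_splits_cons mulr_sumr; apply: eq_bigr => p _.
have -> : fmu x = FMonom [:: x] by apply: val_inj; rewrite /= fmU.
by rewrite one_word mulrDl [LHS]addrC; congr (_ + _); apply: malgUM2.
Qed.

(** What the smash product does once its left factor has been applied: [v] is the tensor factor
    which that map skips, and [g] acts on [v] followed by one half of the argument. *)
Definition smash_tail (g : {linear T -> T}) (v : seq I) : T -> T :=
  lin_ext (fun y : {fmonom I} => \sum_(q <- splits y)
    lin_ext (fun z : {fmonom I} => << FMonom (q.2 ++ z) >>)
      (g << FMonom (v ++ q.1) >>)).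
HB.instance Definition _ (g : {linear T -> T}) (v : seq I) :=
  GRing.Linear.copy (smash_tail g v)
    (lin_ext (fun y : {fmonom I} => \sum_(q <- splits y)
    lin_ext (fun z : {fmonom I} => << FMonom (q.2 ++ z) >> : T)
      (g << FMonom (v ++ q.1) >>))).

Lemma tens_mapU (K L K' L' : choiceType)
    (f : {linear {malg k[K]} -> {malg k[K']}})
    (g : {linear {malg k[L]} -> {malg k[L']}}) (x : K) (y : L) :
  tens_map f g << (x, y) >> = tens (f << x >>) (g << y >>).
Proof. exact: lin_extU. Qed.

Lemma linear_tens_l (K L : choiceType) (M : lmodType k)
    (h : {linear {malg k[(K * L)%type]} -> M}) (a : {malg k[K]}) (y : L) :
  h (tens a << y >>) = lin_ext (fun x => h << (x, y) >>) a.
Proof.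
by rewrite /tens linear_lin_ext; apply: eq_lin_ext => x; rewrite lin_extU.
Qed.

Lemma linear_tens_r (K L : choiceType) (M : lmodType k)
    (h : {linear {malg k[(K * L)%type]} -> M}) (x : K) (b : {malg k[L]}) :
  h (tens << x >> b) = lin_ext (fun y => h << (x, y) >>) b.
Proof. by rewrite /tens lin_extU linear_lin_ext. Qed.

Lemma tensU (K L : choiceType) (x : K) (y : L) :
  tens << x >> << y >> = << (x, y) >> :> {malg k[(K * L)%type]}.
Proof. by rewrite /tens !lin_extU. Qed.

Lemma tens_suml (K L J : choiceType) (r : seq J) (a : J -> {malg k[K]})
    (b : {malg k[L]}) :
  tens (\sum_(j <- r) a j) b = \sum_(j <- r) tens (a j) b.
Proof. by rewrite /tens linear_sum. Qed.

Lemma cyclicU (K L N : choiceType) (x : K) (y : L) (z : N) :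
  cyclic << (x, y, z) >> = << (y, (z, x)) >> :> {malg k[(L * (N * K))%type]}.
Proof. exact: lin_extU. Qed.

Lemma multU (x y : {fmonom I}) : mult << (x, y) >> = << mmul x y >> :> T.
Proof. exact: lin_extU. Qed.

Lemma smash_word (f g : {linear T -> T}) (w : seq I) :
  smash f g << FMonom w >> =
  \sum_(p <- splits w) smash_tail g p.2 (f << FMonom p.1 >>).
Proof.
(* The maps after the coproducts are bundled into one linear map, so that sums can be pulled out
   through it. *)
pose L : {linear {malg k[({fmonom I} * {fmonom I} * {fmonom I})%type]} -> T} :=
  (@mult k I) \o tens_map idfun g \o tens_map idfun (@mult k I) \o
  @cyclic k {fmonom I} {fmonom I} {fmonom I}.
pose L2 : {linear T2 -> T} := L \o tens_map (@comult k I) idfun.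
rewrite -[LHS]/(L2 (tens_map f idfun (comult << FMonom w >>))).
rewrite comultE (linear_sum (tens_map f idfun)) (linear_sum L2).
apply: eq_bigr => p _.
rewrite -[LHS]/(L2 (tens_map f idfun << (FMonom p.1, FMonom p.2) >>)).
rewrite tens_mapU linear_tens_l /smash_tail; apply: eq_lin_ext => y.
rewrite -[LHS]/(L (tens_map (@comult k I) idfun << (y, FMonom p.2) >>)).
rewrite tens_mapU -[LHS]/(L (tens (comult << y >>) << FMonom p.2 >>)).
rewrite {1}(_ : y = FMonom y) ?comultE; last exact: val_inj.
rewrite tens_suml (linear_sum L); apply: eq_bigr => q _; rewrite tensU.
rewrite -[LHS]/(mult (tens_map idfun g (tens_map idfun (@mult k I)
  (cyclic << (FMonom q.1, FMonom q.2, FMonom p.2) >>)))).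
rewrite cyclicU tens_mapU -[LHS]/(mult (tens_map idfun g
  (tens << FMonom q.2 >> (mult << (FMonom p.2, FMonom q.1) >>)))).
rewrite multU mmul_FMonom tensU tens_mapU linear_tens_r.
by apply: eq_lin_ext => -[z]; apply: etrans (multU _ _) _; rewrite mmul_FMonom.
Qed.
End SmashWords.

(** * [Sigma] as a subspace, with its induction principle *)

Section SigmaClosure.
Variable k : fieldType.
Implicit Types (x y : sym_sum k).

Lemma span_lin (M : lmodType k) (P : M -> Prop) (c : k) (x y : M) :
  Defs.span P x -> Defs.span P y -> Defs.span P (c *: x + y).
Proof.
move=> [s sP ->] [t tP ->]; exists ([seq (c * p.1, p.2) | p <- s] ++ t).
  by move=> p; rewrite mem_cat => /orP[/mapP[q /sP Pq ->]|/tP].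
rewrite big_cat big_map scaler_sumr; congr (_ + _).
by apply: eq_bigr => p _; rewrite scalerA.
Qed.

Lemma span0 (M : lmodType k) (P : M -> Prop) : Defs.span P 0.
Proof. by exists [::] => //; rewrite big_nil. Qed.

Lemma Sigma0 : Sigma (0 : sym_sum k).
Proof.
by exists 0%N, (fun=> 0); split=> [n|]; [apply: span0 | rewrite big_ord0].
Qed.

Lemma Sigma_lin (c : k) x y : Sigma x -> Sigma y -> Sigma (c *: x + y).
Proof.
(* Two elements come with different degree bounds; padding by zero components makes any larger bound
   admissible. *)
have widen z : Sigma z -> exists N (f : nat -> sym_sum k),
    (forall n, Sigma_ n (f n)) /\ forall N', (N <= N')%N -> z = \sum_(n < N') f n.
  move=> [N [f [fS ->]]]; exists N, (fun n => if (n < N)%N then f n else 0).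
  split=> [n|N' NN']; first by case: ifP => // _; apply: span0.
  by rewrite -big_mkcond -(big_ord_widen _ _ NN').
move=> /widen[N [f [fS fE]]] /widen[N' [f' [fS' fE']]].
exists (maxn N N'), (fun n => c *: f n + f' n).
split=> [n|]; first by apply: span_lin; [apply: fS | apply: fS'].

rewrite (fE _ (leq_maxl N N')) (fE' _ (leq_maxr N N')) scaler_sumr.
by rewrite -big_split.
Qed.

Lemma Sigma_X n al : is_composition n al -> Sigma (X k n al).
Proof.
move=> cal; exists n.+1, (fun m => if m == n then X k n al else 0); split=> [m|].
  case: eqP => [->|_]; last exact: span0.
  exists [:: (1, X k n al)]; last by rewrite big_seq1 scale1r.
  by move=> p; rewrite inE => /eqP ->; exists al.
by rewrite -big_mkcond (big_pred1 ord_max).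
Qed.

Lemma Sigma_sum (J : Type) (r : seq J) (P : pred J) (F : J -> sym_sum k) :
  (forall j, P j -> Sigma (F j)) -> Sigma (\sum_(j <- r | P j) F j).
Proof.
move=> FS; apply: big_rec => [|j x Pj xS]; first exact: Sigma0.
by rewrite -[F j]scale1r; apply: Sigma_lin => //; apply: FS.
Qed.

Lemma Sigma_ind (Q : sym_sum k -> Prop) : Q 0 ->
  (forall c x y, Q x -> Q y -> Q (c *: x + y)) ->
  (forall n al, is_composition n al -> Q (X k n al)) ->
  forall x, Sigma x -> Q x.
Proof.
move=> Q0 Qlin QX x [N [f [fS ->]]].
apply: big_ind => // [y z Qy Qz|n _]; first by rewrite -[y]scale1r; apply: Qlin.
have [s sP ->] := fS n; rewrite big_seq.
apply: big_rec => // p y /sP[al cal ->] Qy.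
by apply: Qlin => //; apply: QX.
Qed.
End SigmaClosure.

(** * Bounds on the matrices of sizes *)

Section SumBounds.

Lemma sumn_add_seq (s t : seq nat) : size s = size t ->
  sumn (add_seq s t) = (sumn s + sumn t)%N.
Proof.
by elim: s t => [|a s IH] [|b t] //= [/IH]; rewrite /add_seq => ->; rewrite addnACA.
Qed.

Lemma size_col_sums (r s : nat) (ns : seq nat) : size ns = (s * r)%N ->
  size (col_sums r s ns) = r.
Proof.
elim: s ns => [|s IH] ns sz /=; first by rewrite size_nseq.
rewrite size_map size_zip IH ?size_drop ?sz ?mulSn ?addKn //.
by rewrite size_takel ?minnn // sz mulSn leq_addr.
Qed.

Lemma sumn_row_sums (r s : nat) (ns : seq nat) : size ns = (s * r)%N ->
  sumn (row_sums r s ns) = sumn ns.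
Proof.
elim: s ns => [|s IH] ns sz /=; first by rewrite (size0nil sz).
by rewrite IH ?size_drop ?sz ?mulSn ?addKn // -sumn_cat cat_take_drop.
Qed.

(** The right sizes count every matrix entry and the left sizes count all the other entries. Entries
    outside column 0 are counted twice, hence an inequality. *)
Lemma sumn_smash (r s : nat) (ns : seq nat) : size ns = (r + s * r.+1)%N ->
  (sumn ns <= sumn (smash_left r s ns) + sumn (smash_right r s ns))%N.
Proof.
move=> sz; have sz' : size (drop r ns) = (s * r.+1)%N by rewrite size_drop sz addKn.
rewrite sumn_row_sums // sumn_add_seq; last first.
  by rewrite size_behead size_col_sums // size_takel // sz leq_addr.
rewrite -{1}(cat_take_drop r ns) sumn_cat leq_add2r.
exact: leq_addl.
Qed.
End SumBounds.

(** * Bilinearity, and the product of two basis elements *)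

Section SmashDescents.
Variables (k : fieldType) (I : choiceType).
Local Notation T := {malg k[{fmonom I}]}.
Implicit Types (f g h : {linear T -> T}).

Lemma lin_ext_lin (K : choiceType) (M : lmodType k) (c : k) (phi psi : K -> M)
    (a : {malg k[K]}) :
  lin_ext (fun x => c *: phi x + psi x) a = c *: lin_ext phi a + lin_ext psi a.
Proof.
rewrite /lin_ext scaler_sumr -big_split; apply: eq_bigr => x _ /=.
by rewrite scalerDr !scalerA mulrC.
Qed.

Lemma sym_end_lin (c : k) (x y : sym_sum k) (z : T) :
  sym_end I (c *: x + y) z = c *: sym_end I x z + sym_end I y z.
Proof.
rewrite /sym_end -lin_ext_lin; apply: eq_lin_ext => w.
exact: (linearP (lin_ext (fun s => perm_word k (tagged s) w))).
Qed.

Lemma sym_end0 (z : T) : sym_end I (0 : sym_sum k) z = 0.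
Proof.
have := sym_end_lin 1 0 0 z.
by rewrite !scale1r addr0 -{1}[sym_end I 0 z]addr0 => /addrI.
Qed.

Lemma sym_end_sum (J : finType) (P : pred J) (F : J -> sym_sum k) (z : T) :
  sym_end I (\sum_(j | P j) F j) z = \sum_(j | P j) sym_end I (F j) z.
Proof.
apply: (big_morph (fun x => sym_end I x z)) => [x y|]; last exact: sym_end0.
by have := sym_end_lin 1 x y z; rewrite !scale1r.
Qed.

Lemma malg_linear_comb (K : choiceType) (M : lmodType k) (c : k)
    (f g h : {linear {malg k[K]} -> M}) :
  (forall x, h << x >> = c *: f << x >> + g << x >>) ->
  forall a, h a = c *: f a + g a.
Proof.
move=> hE a; rewrite (monalgE a) !linear_sum -big_split.
apply: eq_bigr => x _ /=; rewrite malgUE !linearZ hE /=.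
by rewrite scalerDr !scalerA mulrC.
Qed.

Lemma smash_linl f g h h' (c : k) : (forall z, h z = c *: f z + g z) ->
  forall z, smash h h' z = c *: smash f h' z + smash g h' z.
Proof.
move=> hE; apply: (malg_linear_comb (f := smash f h') (g := smash g h')
  (h := smash h h')) => w.
have -> : w = FMonom w by apply: val_inj.
rewrite -[LHS]/(smash h h' _) -[RHS]/(c *: smash f h' _ + smash g h' _).
rewrite !smash_word scaler_sumr -big_split; apply: eq_bigr => p _ /=.
by rewrite hE (linearP (smash_tail h' p.2)).
Qed.

Lemma smash_linr f g h h' (c : k) : (forall z, h z = c *: f z + g z) ->
  forall z, smash h' h z = c *: smash h' f z + smash h' g z.
Proof.
move=> hE; apply: (malg_linear_comb (f := smash h' f) (g := smash h' g)
  (h := smash h' h)) => w.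
have -> : w = FMonom w by apply: val_inj.
rewrite -[LHS]/(smash h' h _) -[RHS]/(c *: smash h' f _ + smash h' g _).
rewrite !smash_word scaler_sumr -big_split; apply: eq_bigr => p _ /=.
rewrite /smash_tail -lin_ext_lin; apply: eq_lin_ext => y.
rewrite scaler_sumr -big_split; apply: eq_bigr => q _ /=.
by rewrite hE linearP.
Qed.

Lemma nth_leq_sumn (ns : seq nat) i : (nth 0 ns i <= sumn ns)%N.
Proof.
elim: ns i => [|a ns IH] [|i] //=; first exact: leq_addr.
exact: leq_trans (IH i) (leq_addl _ _).
Qed.

Lemma sumn_pos (ns : seq nat) : sumn [seq a <- ns | 0 < a]%N = sumn ns.
Proof. by elim: ns => [|[|a] ns IH] //=; rewrite IH. Qed.

(** The tuples range over a finite type: by [sumn_smash], no entry of a size vector with these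
    margins exceeds [sumn al + sumn be]. *)
Definition smash_X (al be : seq nat) : sym_sum k :=
  \sum_(t : (size al + size be * (size al).+1).-tuple 'I_(sumn al + sumn be).+1
    | (smash_left (size al) (size be) (map val t) == al) &&
      (smash_right (size al) (size be) (map val t) == be))
    X k (sumn (map val t)) [seq a <- map val t | 0 < a]%N.

Lemma Sigma_smash_X al be : Sigma (smash_X al be).
Proof.
apply: Sigma_sum => t _; apply: Sigma_X.
by rewrite /is_composition filter_all sumn_pos eqxx.
Qed.

Lemma smash_X_word (al be : seq nat) (w : seq I) :
  sym_end I (smash_X al be) << FMonom w >> =
  \sum_(us <- rsplits (size al + size be * (size al).+1) w)
    if (smash_left (size al) (size be) (map size us) == al) &&
       (smash_right (size al) (size be) (map size us) == be)
    then << FMonom (flatten us) >> else 0.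
Proof.
set N := (size al + _)%N; set K := (sumn al + sumn be)%N.
pose cond ns := (smash_left (size al) (size be) ns == al) &&
  (smash_right (size al) (size be) ns == be).
rewrite sym_end_sum -(big_mkcond (fun us => cond (map size us))) /=.
pose p (us : seq (seq I)) : N.-tuple 'I_K.+1 :=
  [tuple inord (nth 0%N (map size us) i) | i < N].
(* [inord] truncates nothing here, since the sizes respect the bound. *)
have pE us : us \in rsplits N w -> cond (map size us) -> map val (p us) = map size us.
  move=> /size_rsplits sz /andP[/eqP cl /eqP cr].
  apply: (@eq_from_nth _ 0%N) => [|i]; rewrite size_map size_tuple.
    by rewrite size_map sz.
  move=> iN; rewrite (nth_map ord0) ?size_tuple //.
  rewrite -[i]/(val (Ordinal iN)) -tnth_nth tnth_mktuple.
  rewrite /= inordK // ltnS; apply: leq_trans (nth_leq_sumn _ _) _.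
  rewrite /K -{1}cr -{1}cl; apply: sumn_smash.
  by rewrite size_map sz.
(* Splittings are grouped by their size vector [t]; each group is the action of one [X] on [w], by
   [sym_end_X] and [big_unshuffles_pos]. *)
rewrite [RHS]big_seq_cond (partition_big p (fun t => cond (map val t))) /=; last first.
  by move=> us /andP[usw cus]; rewrite pE.
apply: eq_bigr => t ct; rewrite sym_end_X ?sumn_pos // /unshuffle_sum.
rewrite big_unshuffles_pos big_unshuffles size_map size_tuple [LHS]big_seq_cond.
apply: eq_bigl => us; case: (boolP (us \in _)) => //= usN.
apply/eqP/andP => [e|[cus /eqP <-]]; last by rewrite pE.
split; first by rewrite /cond e.
apply/eqP/val_inj/(inj_map val_inj) => /=; rewrite -[RHS]e.
by apply: pE => //; rewrite /cond e.
Qed.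

Lemma smash_tailU (n : nat) (al : seq nat) (v u : seq I) : sumn al = n ->
  smash_tail (sym_end I (X k n al)) v << FMonom u >> =
  \sum_(q <- splits u) \sum_(vs <- rsplits (size al) (v ++ q.1))
    if map size vs == al then << FMonom (q.2 ++ flatten vs) >> else 0.
Proof.
move=> sn; rewrite /smash_tail lin_extU; apply: eq_bigr => q _.
rewrite -[X in lin_ext _ X]/(sym_end I (X k n al) _) sym_end_X //.
rewrite /unshuffle_sum linear_sum /= big_unshuffles big_mkcond.
by apply: eq_bigr => vs _; case: ifP => // _; rewrite lin_extU.
Qed.

(** On words the smash product is the left side of [big_rsplits_smash], with [F] testing the two
    size vectors against [al] and [be]. *)
Lemma smash_XX (m n : nat) (al be : seq nat) : sumn al = m -> sumn be = n ->
  sym_end I (smash_X al be) =1 smash (sym_end I (X k m al)) (sym_end I (X k n be)).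
Proof.
move=> sm sn; apply: malg_linear_ext => w.
have -> : w = FMonom w by apply: val_inj.
rewrite -[LHS]/(sym_end I (smash_X al be) _) smash_X_word.
rewrite -[RHS]/(smash (sym_end I (X k m al)) (sym_end I (X k n be)) _) smash_word.
rewrite -(big_rsplits_smash _ _ _ (fun ns ms u =>
  if (ns == al) && (ms == be) then << FMonom u >> else 0)).
apply: eq_bigr => p _; rewrite -[X in smash_tail _ _ X]/(sym_end I (X k m al) _).
rewrite sym_end_X // /unshuffle_sum (linear_sum (smash_tail _ p.2)).
rewrite big_unshuffles [RHS]big_mkcond; apply: eq_bigr => us _.
case: ifP => _ /=; last by rewrite big1 // => q _; rewrite big1.
by rewrite smash_tailU.
Qed.
End SmashDescents.

Theorem theorem3p1 (k : fieldType) (I : choiceType)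
    (char0 : [pchar k] =i pred0)
    (infI : forall s : seq I, exists i, i \notin s)
    (a b : sym_sum k) (Sa : Sigma a) (Sb : Sigma b) :
  exists2 c : sym_sum k, Sigma c & sym_end I c =1 smash (sym_end I a) (sym_end I b).
Proof.
(* Linearity is available only for combinations [c *: f + g], so the zero map is written as
   $(-1)\cdot 0+0$. *)
have smash0l h z : smash (sym_end I (0 : sym_sum k)) h z = 0.
  have E z' : sym_end I (0 : sym_sum k) z' =
      (-1) *: sym_end I (0 : sym_sum k) z' + sym_end I (0 : sym_sum k) z'.
    by rewrite !sym_end0 scaler0 addr0.
  by rewrite (smash_linl h E) scaleN1r addNr.
have smash0r h z : smash h (sym_end I (0 : sym_sum k)) z = 0.
  have E z' : sym_end I (0 : sym_sum k) z' =
      (-1) *: sym_end I (0 : sym_sum k) z' + sym_end I (0 : sym_sum k) z'.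
    by rewrite !sym_end0 scaler0 addr0.
  by rewrite (smash_linr h E) scaleN1r addNr.
(* Induction on the left argument and then, for a fixed basis element there, on the right one. *)
move: a Sa; apply: Sigma_ind => [|c x y [x' Sx' Ex] [y' Sy' Ey]|m al /andP[_ /eqP sal]].
- by exists 0 => [|z]; [apply: Sigma0 | rewrite smash0l sym_end0].
- exists (c *: x' + y') => [|z]; first exact: Sigma_lin.
  rewrite sym_end_lin Ex Ey; symmetry.
  exact: (@smash_linl _ _ (sym_end I x) (sym_end I y) (sym_end I (c *: x + y))
    (sym_end I b) c (sym_end_lin c x y) z).
move: b Sb; apply: Sigma_ind => [|c x y [x' Sx' Ex] [y' Sy' Ey]|n be /andP[_ /eqP sbe]].
- by exists 0 => [|z]; [apply: Sigma0 | rewrite smash0r sym_end0].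
- exists (c *: x' + y') => [|z]; first exact: Sigma_lin.
  rewrite sym_end_lin Ex Ey; symmetry.
  exact: (@smash_linr _ _ (sym_end I x) (sym_end I y) (sym_end I (c *: x + y))
    (sym_end I (X k m al)) c (sym_end_lin c x y) z).
- by exists (smash_X k al be); [apply: Sigma_smash_X | apply: smash_XX].
Qed.
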